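(* Let $A_1,A_2\in\mathbb C^{N\times N}$, $C\in\mathbb C^{p\times N}$, $B\in\mathbb C^{N\times q}$, where $(C,A_1)$ is an observable pair and $(A_2,B)$ is a controllable pair. The function $$f(m,n)=CA_1^mA_2^nB,\qquad (m,n)\in\mathbb N_0\times\mathbb N_0,$$ is discrete analytic if and only if $$I+iA_1-iA_2-A_1A_2=0.$$ In that case $iI+A_1$ is invertible, $A_1$ and $A_2$ commute, and $A_2=(iI+A_1)^{-1}(I+iA_1)$.
   Context: A matrix-valued function $f$ on $\mathbb N_0\times\mathbb N_0$ (identified with $\Lambda_{++}=\mathbb N_0+i\mathbb N_0$) is discrete analytic if $f(m,n)+if(m+1,n)-if(m,n+1)-f(m+1,n+1)=0$ for all $m,n\in\mathbb N_0$. The pair $(C,A_1)$ is observable if $\bigcap_{n\ge0}\ker CA_1^n=\{0\}$; the pair $(A_2,B)$ is controllable if the ranges of $A_2^nB$, $n\ge0$, together span $\mathbb C^N$. *)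

(* Defs.v *)
From mathcomp Require Import all_boot all_order all_algebra.
From mathcomp Require Import reals complex.

Set Implicit Arguments.
Unset Strict Implicit.
Unset Printing Implicit Defensive.

Import GRing.Theory.
Local Open Scope ring_scope.

Section Definitions.

Variable R : realType.

Definition discrete_analytic (p q : nat) (f : nat -> nat -> 'M[R[i]]_(p, q)) :=
  forall m n : nat,
    f m n + 'i%C *: f m.+1 n - 'i%C *: f m n.+1 - f m.+1 n.+1 = 0.

Definition observable (N p : nat) (C : 'M[R[i]]_(p, N)) (A : 'M[R[i]]_N) :=
  forall x : 'cV[R[i]]_N, (forall n : nat, C *m A ^+ n *m x = 0) -> x = 0.

(* <<s>> is the span of a finite list, so the span of the infinite union of the
   ranges is rendered as the union of the spans of its finite subfamilies. *)
Definition controllable (N q : nat) (A : 'M[R[i]]_N) (B : 'M[R[i]]_(N, q)) :=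
  forall v : 'cV[R[i]]_N, exists s : seq 'cV[R[i]]_N,
    (forall w, w \in s ->
       exists (n : nat) (u : 'cV[R[i]]_q), w = A ^+ n *m B *m u) /\
    v \in <<s>>%VS.

End Definitions.

(* Main.v *)
Require Import Defs.
From mathcomp Require Import all_boot all_order all_algebra.
From mathcomp Require Import reals complex.

Import GRing.Theory.
Local Open Scope ring_scope.

(** Put E = I + i A1 - i A2 - A1 A2.  The expression whose vanishing defines
    discrete analyticity of C A1^m A2^n B is C A1^m E A2^n B, so E = 0 is
    clearly sufficient.  Conversely, if all these products vanish, observability
    of (C, A1) removes C A1^m from the left, giving E A2^n B = 0 for all n, and
    then E is zero on the ranges of the A2^n B, which span by controllability.
    For the last part, i^2 = -1 gives E = 2 I - (i I + A1) (A2 - i I).  Hence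
    E = 0 makes (A2 - i I) / 2 a right inverse of i I + A1, hence, these matrices
    being square, a two-sided one.  So i I + A1 and A2 - i I commute, and so do
    A1 and A2, which differ from them by scalar matrices.  The formula for
    A2 is E = 0 rewritten as (i I + A1) A2 = I + i A1. *)

(** The shifts in m and n insert their extra factors A1 and A2 exactly
    between A1^m and A2^n, so the outer factors can be pulled out. *)
Lemma discrete_analytic_defect (R : realType) (N p q : nat)
    (A1 A2 : 'M[R[i]]_N) (C : 'M[R[i]]_(p, N)) (B : 'M[R[i]]_(N, q))
    (m n : nat) :
  let f := fun m n : nat => C *m A1 ^+ m *m A2 ^+ n *m B in
  f m n + 'i%C *: f m.+1 n - 'i%C *: f m n.+1 - f m.+1 n.+1 =
  C *m A1 ^+ m *m (1%:M + 'i%C *: A1 - 'i%C *: A2 - A1 *m A2)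
    *m A2 ^+ n *m B.
Proof.
rewrite /= (exprSr A1) (exprS A2) -!mulmxE !(mulmxDr, mulmxDl, mulmxN, mulNmx).
by rewrite mulmx1 -!(scalemxAl, scalemxAr) !mulmxA.
Qed.

(** Observability speaks of single vectors; it is applied to each column of X. *)
Lemma observable_cancel {R : realType} {N p r : nat}
    {A : 'M[R[i]]_N} {C : 'M[R[i]]_(p, N)} {X : 'M[R[i]]_(N, r)} :
  observable C A -> (forall m, C *m A ^+ m *m X = 0) -> X = 0.
Proof.
move=> obs CAX0; apply/matrixP=> k j.
have /matrixP/(_ k 0) : col j X = 0.
  by apply: obs => m; rewrite colE mulmxA CAX0 mul0mx.
by rewrite !mxE.
Qed.

(** X kills the ranges of all the A^n B; every vector is a finite combination of
    elements of these, so X kills it too. *)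
Lemma controllable_cancel {R : realType} {N q r : nat}
    {A : 'M[R[i]]_N} {B : 'M[R[i]]_(N, q)} {X : 'M[R[i]]_(r, N)} :
  controllable A B -> (forall n, X *m A ^+ n *m B = 0) -> X = 0.
Proof.
move=> ctrl XAB0.
have Xv0 (v : 'cV_N) : X *m v = 0.
  have [s [s_range v_s]] := ctrl v.
  rewrite (coord_span (X := in_tuple s) v_s) mulmx_sumr big1 // => k _.
  have [n [u su]] := s_range _ (mem_nth 0 (ltn_ord k)).
  by rewrite -scalemxAr /= su !mulmxA XAB0 mul0mx scaler0.
apply/matrixP=> k j.
have /matrixP/(_ k 0) := Xv0 (delta_mx j 0).
by rewrite -colE !mxE.
Qed.

(** This factorization is what turns the vanishing of the left-hand side into
    an invertibility statement. *)
Lemma defect_factor (R : realType) (N : nat) (A B : 'M[R[i]]_N) :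
  1%:M + 'i%C *: A - 'i%C *: B - A *m B =
  2%:M - ('i%C%:M + A) *m (B - 'i%C%:M).
Proof.
have i2 : 'i%C * 'i%C = -1 :> R[i] by rewrite -expr2 sqr_i.
apply/eqP; rewrite eq_sym subr_eq; apply/eqP.
rewrite mulmxDl !mulmxBr !mul_scalar_mx mul_mx_scalar scale_scalar_mx i2.
rewrite rmorphN /= opprK -[2]/(1 + 1) rmorphD /=.
rewrite -!addrA; congr (_ + _).
rewrite ['i%C *: A + _]addrC -!addrA.
by rewrite addNr addr0 [1%:M + A *m B]addrC [- (A *m B) + _]addrCA !addKr.
Qed.

Theorem theorem2p30 (R : realType) (N p q : nat)
    (A1 A2 : 'M[R[i]]_N) (C : 'M[R[i]]_(p, N)) (B : 'M[R[i]]_(N, q))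
    (obs : observable C A1) (ctrl : controllable A2 B) :
  let f := fun m n : nat => C *m A1 ^+ m *m A2 ^+ n *m B in
  (discrete_analytic f <->
     1%:M + 'i%C *: A1 - 'i%C *: A2 - A1 *m A2 = 0) /\
  (discrete_analytic f ->
     'i%C%:M + A1 \in unitmx /\
     A1 *m A2 = A2 *m A1 /\
     A2 = invmx ('i%C%:M + A1) *m (1%:M + 'i%C *: A1)).
Proof.
move=> f.
set E := (X in X = 0).
have E0 : discrete_analytic f <-> E = 0.
  split=> [fDA | E0 m n]; last first.
    by rewrite discrete_analytic_defect -/E E0 mulmx0 !mul0mx.
  apply: (controllable_cancel ctrl) => n.
  apply: (observable_cancel obs) => m.
  by rewrite !mulmxA -discrete_analytic_defect fDA.
split=> // /E0 {}E0.
have two_neq0 : 2 != 0 :> R[i] by rewrite Num.Theory.pnatr_eq0.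
set U := 'i%C%:M + A1.
set V := A2 - 'i%C%:M.
have UV : U *m V = 2%:M.
  by apply/esym/eqP; rewrite -subr_eq0 -defect_factor -/E E0.
have UV1 : U *m (2^-1 *: V) = 1%:M.
  by rewrite -scalemxAr UV scale_scalar_mx mulVf.
have [U_unit _] := mulmx1_unit UV1.
have VU : V *m U = 2%:M.
  have := mulmx1C UV1; rewrite -scalemxAl => /(congr1 ( *:%R 2)).
  by rewrite scalerA mulfV // scale1r scale_scalar_mx mulr1.
split=> //; split.
  have UVcomm : comm_mx U V by rewrite /comm_mx UV VU.
  have -> : A1 = U - 'i%C%:M by rewrite /U addrC addKr.
  have -> : A2 = V + 'i%C%:M by rewrite /V subrK.
  apply: comm_mxD; last exact: comm_mx_scalar.
  apply/comm_mx_sym/comm_mxB; first exact: comm_mx_sym.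
  exact: comm_mx_scalar.
have UA2 : U *m A2 = 1%:M + 'i%C *: A1.
  apply/esym/eqP; rewrite -subr_eq0 mulmxDl mul_scalar_mx opprD addrA.
  by rewrite -/E E0.
by rewrite -UA2 mulKmx.
Qed.
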